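(* If $G$ is an abelian group of bounded exponent and $G=\bigoplus_pG_p$ is its primary decomposition, then $$\mathrm{Pol}_2^{ab}(G)\cong\bigoplus_p\mathrm{Pol}_2^{ab}(G_p).$$
   Context: For groups $G,H$ and $\varphi\colon G\to H$, put $(\Delta_k\varphi)(g):=\varphi(kg)\varphi(g)^{-1}$. A map is polynomial of degree $-1$ if it is constantly $1$, and polynomial of degree $d+1$ ($d\ge-1$) if $\Delta_k\varphi$ is polynomial of degree $d$ for all $k\in G$; quadratic means polynomial of degree $2$; unital means $\varphi(1)=1$. $\mathrm{Pol}_2(G)$ is the group with a universal unital quadratic map $\varphi\colon G\to\mathrm{Pol}_2(G)$: every unital quadratic map $G\to H$ to a group $H$ factors through $\varphi$ via a unique homomorphism $\mathrm{Pol}_2(G)\to H$. $\mathrm{Pol}_2^{ab}(G)$ denotes the abelianization of $\mathrm{Pol}_2(G)$. For a prime $p$, $G_p$ is the $p$-primary part of $G$. *)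

(* Defs.v *)
From HB Require Import structures.
From mathcomp Require Import all_boot all_order all_algebra.
From mathcomp Require Import boolp classical_sets cardinality.

Set Implicit Arguments.
Unset Strict Implicit.
Unset Printing Implicit Defensive.

Import GRing.Theory.
Import Algebra.

Local Open Scope group_scope.
Local Open Scope quotient_scope.

Definition Delta (G H : groupType) (k : G) (phi : G -> H) : G -> H :=
  fun g => phi (k * g) * (phi g)^-1.

(* The degree is shifted by one, so that it starts from -1:
   [polynomialS n phi] says that [phi] is polynomial of degree [n - 1]. *)
Fixpoint polynomialS (n : nat) (G H : groupType) (phi : G -> H) : Prop :=
  if n is m.+1 then forall k : G, polynomialS m (Delta k phi)
  else forall g : G, phi g = 1.

Definition quadratic (G H : groupType) (phi : G -> H) : Prop :=
  polynomialS 3 phi.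

Definition unital (G H : groupType) (phi : G -> H) : Prop := phi 1 = 1.

(* [is_Pol2 phi] says that [P], together with [phi], is Pol_2(G). *)
Definition is_Pol2 (G P : groupType) (phi : G -> P) : Prop :=
  [/\ quadratic phi, unital phi &
    forall (H : groupType) (psi : G -> H), quadratic psi -> unital psi ->
      exists f : {multiplicative P -> H}, f \o phi =1 psi /\
        forall g : {multiplicative P -> H}, g \o phi =1 psi -> g =1 f].

Inductive derived (P : groupType) : P -> Prop :=
| derived_comm x y : derived [~ x, y]
| derived1 : derived 1
| derivedM x y : derived x -> derived y -> derived (x * y)
| derivedV x : derived x -> derived x^-1.

Section Abelianization.
Variable P : groupType.

Lemma derivedJ (x y : P) : derived x -> derived (x ^ y).
Proof.
move=> dx; rewrite -[x ^ y](mulVKg x) -commgEl.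
by apply: derivedM => //; apply: derived_comm.
Qed.

Definition derived_rel (x y : P) : bool := `[< derived (x / y) >].

Lemma derived_rel_equiv : equiv_class_of derived_rel.
Proof.
split=> [x|x y|y x z].
- by apply/asboolP; rewrite divgg; apply: derived1.
- by apply/asboolP/asboolP => /derivedV; rewrite invgF.
- move=> /asboolP dxy /asboolP dyz; apply/asboolP.
  by rewrite -(mulgVK y x) -mulgA; apply: derivedM.
Qed.

Canonical derived_equiv := EquivRelPack derived_rel_equiv.

Definition abelianization : Type := {eq_quot derived_equiv}.

HB.instance Definition _ := Choice.on abelianization.

Definition ab_proj (x : P) : abelianization := \pi_({eq_quot derived_equiv}) x.

Lemma ab_projP (x y : P) : ab_proj x = ab_proj y <-> derived (x / y).
Proof.
split=> [/eqmodP /asboolP //|d].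
by apply/eqmodP/asboolP.
Qed.

Definition ab_repr (a : abelianization) : P :=
  repr (a : {eq_quot derived_equiv}).

Lemma ab_reprK (a : abelianization) : ab_proj (ab_repr a) = a.
Proof. exact: reprK. Qed.

Definition ab_add (a b : abelianization) := ab_proj (ab_repr a * ab_repr b).
Definition ab_zero := ab_proj 1.
Definition ab_opp (a : abelianization) := ab_proj (ab_repr a)^-1.

Lemma ab_proj_add (x y : P) :
  ab_add (ab_proj x) (ab_proj y) = ab_proj (x * y).
Proof.
have /ab_projP dx := ab_reprK (ab_proj x).
have /ab_projP dy := ab_reprK (ab_proj y).
apply/ab_projP; set x' := ab_repr _; set y' := ab_repr _.
have -> : x' * y' / (x * y) = (x' / x) * (y' / y) ^ x^-1.
  by rewrite conjgE invgK invgM !mulgA mulgVK.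
by apply: derivedM => //; apply: derivedJ.
Qed.

Lemma ab_proj_opp (x : P) : ab_opp (ab_proj x) = ab_proj x^-1.
Proof.
have /ab_projP dx := ab_reprK (ab_proj x).
apply/ab_projP; set x' := ab_repr _.
have -> : x'^-1 / x^-1 = ((x' / x)^-1) ^ x by rewrite conjgE invgF invgK -mulgA mulKg.
by apply: derivedJ; apply: derivedV.
Qed.

Lemma ab_addA : associative ab_add.
Proof.
move=> a b c; rewrite -(ab_reprK a) -(ab_reprK b) -(ab_reprK c).
by rewrite !ab_proj_add mulgA.
Qed.

Lemma ab_addC : commutative ab_add.
Proof.
move=> a b; rewrite -(ab_reprK a) -(ab_reprK b) !ab_proj_add.
apply/ab_projP; move: (ab_repr a) (ab_repr b) => x y.
have -> : x * y / (y * x) = [~ x^-1, y^-1] by rewrite commgEl conjgE !invgK invgM !mulgA.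
exact: derived_comm.
Qed.

Lemma ab_add0 : left_id ab_zero ab_add.
Proof. by move=> a; rewrite -(ab_reprK a) ab_proj_add mul1g. Qed.

Lemma ab_addN : left_inverse ab_zero ab_opp ab_add.
Proof. by move=> a; rewrite -(ab_reprK a) ab_proj_opp ab_proj_add mulVg. Qed.

HB.instance Definition _ :=
  GRing.isZmodule.Build abelianization ab_addA ab_addC ab_add0 ab_addN.

Lemma ab_projM (x y : P) : ab_proj (x * y) = (ab_proj x + ab_proj y)%R.
Proof. by rewrite -ab_proj_add. Qed.

End Abelianization.

Section DirectSum.
Local Open Scope ring_scope.
Variables (I : Type) (A : I -> zmodType).

Definition dprod : Type := forall i, A i.

HB.instance Definition _ := Choice.on dprod.

Definition dprod_add (f g : dprod) : dprod := fun i => f i + g i.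
Definition dprod_zero : dprod := fun i => 0.
Definition dprod_opp (f : dprod) : dprod := fun i => - f i.

Lemma dprod_addA : associative dprod_add.
Proof. by move=> f g h; apply: functional_extensionality_dep => i; apply: addrA. Qed.

Lemma dprod_addC : commutative dprod_add.
Proof. by move=> f g; apply: functional_extensionality_dep => i; apply: addrC. Qed.

Lemma dprod_add0 : left_id dprod_zero dprod_add.
Proof. by move=> f; apply: functional_extensionality_dep => i; apply: add0r. Qed.

Lemma dprod_addN : left_inverse dprod_zero dprod_opp dprod_add.
Proof. by move=> f; apply: functional_extensionality_dep => i; apply: addNr. Qed.

HB.instance Definition _ :=
  GRing.isZmodule.Build dprod dprod_addA dprod_addC dprod_add0 dprod_addN.

Definition finsupp : {pred dprod} :=
  fun f => `[< finite_set [set i | f i <> 0] >].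

Lemma finsupp_zmod_closed : zmod_closed finsupp.
Proof.
split=> [|f g /asboolP ff /asboolP fg]; apply/asboolP.
  by apply: (sub_finite_set _ (@finite_set0 I)) => i /=.
have ffg : finite_set ([set i | f i <> 0] `|` [set i | g i <> 0])%classic.
  by rewrite finite_setU.
apply: (sub_finite_set _ ffg) => i /= fgi.
have [fi|/eqP fi] := eqVneq (f i) 0; last by left.
right=> gi; apply: fgi.
by rewrite -[LHS]/(f i - g i) fi gi subr0.
Qed.

HB.instance Definition _ := GRing.isZmodClosed.Build dprod finsupp
  finsupp_zmod_closed.

Record dsum : Type := Dsum { dsum_val :> dprod; _ : dsum_val \in finsupp }.

HB.instance Definition _ := [isSub for dsum_val].
HB.instance Definition _ := [Choice of dsum by <:].
HB.instance Definition _ := [SubChoice_isSubZmodule of dsum by <:].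

End DirectSum.

Section Primary.
Local Open Scope ring_scope.
Variables (G : zmodType) (p : nat).

Definition in_primary : {pred G} :=
  fun x => `[< exists k : nat, x *+ (p ^ k) = 0 >].

Lemma in_primary_zmod_closed : zmod_closed in_primary.
Proof.
split=> [|x y /asboolP[k xk] /asboolP[l yl]]; apply/asboolP.
  by exists 0%N; rewrite mul0rn.
exists (k + l)%N.
by rewrite mulrnBl expnD mulrnA xk mulnC mulrnA yl !mul0rn subr0.
Qed.

HB.instance Definition _ := GRing.isZmodClosed.Build G in_primary
  in_primary_zmod_closed.

Record primary : Type :=
  Primary { primary_val :> G; _ : primary_val \in in_primary }.

HB.instance Definition _ := [isSub for primary_val].
HB.instance Definition _ := [Choice of primary by <:].
HB.instance Definition _ := [SubChoice_isSubZmodule of primary by <:].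

End Primary.

(* Every group has a Pol_2: words in the elements of [G] and their formal
   inverses (marked by [true]), two words being identified when all unital
   quadratic maps give them the same value. *)
Section Pol2.
Variable G : groupType.

Definition word : Type := seq (bool * G).

Definition letter_eval (H : groupType) (psi : G -> H) (l : bool * G) : H :=
  if l.1 then (psi l.2)^-1 else psi l.2.

Definition word_eval (H : groupType) (psi : G -> H) (w : word) : H :=
  foldr (fun l h => letter_eval psi l * h) 1 w.

Lemma word_eval_cat (H : groupType) (psi : G -> H) (v w : word) :
  word_eval psi (v ++ w) = word_eval psi v * word_eval psi w.
Proof. by elim: v => /= [|l v ->]; rewrite ?mul1g ?mulgA. Qed.

Definition word_inv (w : word) : word := [seq (~~ l.1, l.2) | l <- rev w].

Lemma word_eval_inv (H : groupType) (psi : G -> H) (w : word) :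
  word_eval psi (word_inv w) = (word_eval psi w)^-1.
Proof.
rewrite /word_inv; elim: w => /= [|l w IHw]; first by rewrite invg1.
rewrite rev_cons map_rcons -cats1 word_eval_cat IHw invgM; congr (_ * _).
by rewrite /= /letter_eval /= mulg1; case: l.1; rewrite ?invgK.
Qed.

Definition word_rel (v w : word) : bool :=
  `[< forall (H : groupType) (psi : G -> H), quadratic psi -> unital psi ->
        word_eval psi v = word_eval psi w >].

Lemma word_rel_equiv : equiv_class_of word_rel.
Proof.
split=> [v|v w|w v u].
- by apply/asboolP.
- by apply/asboolP/asboolP => e H psi q u; rewrite e.
- move=> /asboolP e /asboolP e'; apply/asboolP => H psi q u1.
  by rewrite e ?e'.
Qed.

Canonical word_equiv := EquivRelPack word_rel_equiv.

Definition Pol2 : Type := {eq_quot word_equiv}.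
HB.instance Definition _ := Choice.on Pol2.

Definition Pol2_pi (w : word) : Pol2 := \pi_({eq_quot word_equiv}) w.
Definition Pol2_repr (x : Pol2) : word := repr (x : {eq_quot word_equiv}).

Definition Pol2_eval (H : groupType) (psi : G -> H) (x : Pol2) : H :=
  word_eval psi (Pol2_repr x).

Lemma Pol2_eval_pi (H : groupType) (psi : G -> H) (w : word) :
  quadratic psi -> unital psi -> Pol2_eval psi (Pol2_pi w) = word_eval psi w.
Proof.
move=> q u; have: Pol2_pi (Pol2_repr (Pol2_pi w)) = Pol2_pi w by apply: reprK.
by move=> /eqmodP/asboolP; apply.
Qed.

Lemma Pol2_eq (x y : Pol2) :
  (forall (H : groupType) (psi : G -> H), quadratic psi -> unital psi ->
    Pol2_eval psi x = Pol2_eval psi y) -> x = y.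
Proof.
move=> e; rewrite -[x]reprK -[y]reprK; apply/eqmodP/asboolP.
exact: e.
Qed.

Definition Pol2_mul (x y : Pol2) := Pol2_pi (Pol2_repr x ++ Pol2_repr y).
Definition Pol2_one := Pol2_pi [::].
Definition Pol2_inv (x : Pol2) := Pol2_pi (word_inv (Pol2_repr x)).

Lemma Pol2_eval_mul (H : groupType) (psi : G -> H) (x y : Pol2) :
  quadratic psi -> unital psi ->
  Pol2_eval psi (Pol2_mul x y) = Pol2_eval psi x * Pol2_eval psi y.
Proof. by move=> q u; rewrite Pol2_eval_pi ?word_eval_cat. Qed.

Lemma Pol2_eval_one (H : groupType) (psi : G -> H) :
  quadratic psi -> unital psi -> Pol2_eval psi Pol2_one = 1.
Proof. by move=> q u; rewrite Pol2_eval_pi. Qed.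

Lemma Pol2_eval_inv (H : groupType) (psi : G -> H) (x : Pol2) :
  quadratic psi -> unital psi ->
  Pol2_eval psi (Pol2_inv x) = (Pol2_eval psi x)^-1.
Proof. by move=> q u; rewrite Pol2_eval_pi ?word_eval_inv. Qed.

Lemma Pol2_mulA : associative Pol2_mul.
Proof.
by move=> x y z; apply: Pol2_eq => H psi q u; rewrite !Pol2_eval_mul ?mulgA.
Qed.

Lemma Pol2_mul1 : left_id Pol2_one Pol2_mul.
Proof.
move=> x; apply: Pol2_eq => H psi q u.
by rewrite Pol2_eval_mul ?Pol2_eval_one ?mul1g.
Qed.

Lemma Pol2_mulr1 : right_id Pol2_one Pol2_mul.
Proof.
move=> x; apply: Pol2_eq => H psi q u.
by rewrite Pol2_eval_mul ?Pol2_eval_one ?mulg1.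
Qed.

Lemma Pol2_mulV : left_inverse Pol2_one Pol2_inv Pol2_mul.
Proof.
move=> x; apply: Pol2_eq => H psi q u.
by rewrite Pol2_eval_mul ?Pol2_eval_one ?Pol2_eval_inv ?mulVg.
Qed.

Lemma Pol2_mulgV : right_inverse Pol2_one Pol2_inv Pol2_mul.
Proof.
move=> x; apply: Pol2_eq => H psi q u.
by rewrite Pol2_eval_mul ?Pol2_eval_one ?Pol2_eval_inv ?mulgV.
Qed.

HB.instance Definition _ := isGroup.Build Pol2
  Pol2_mulA Pol2_mul1 Pol2_mulr1 Pol2_mulV Pol2_mulgV.

Definition pol2 (g : G) : Pol2 := Pol2_pi [:: (false, g)].

Lemma Pol2_eval_pol2 (H : groupType) (psi : G -> H) :
  quadratic psi -> unital psi -> Pol2_eval psi \o pol2 =1 psi.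
Proof. by move=> q u g; rewrite /= Pol2_eval_pi //= mulg1. Qed.

Lemma eq_polynomialS (n : nat) (K H : groupType) (phi psi : K -> H) :
  phi =1 psi -> polynomialS n phi -> polynomialS n psi.
Proof.
by move=> /funext ->.
Qed.

Lemma Pol2_polynomialS (n : nat) (phi : G -> Pol2) :
  (forall (H : groupType) (psi : G -> H), quadratic psi -> unital psi ->
    polynomialS n (Pol2_eval psi \o phi)) -> polynomialS n phi.
Proof.
elim: n phi => /= [|n IHn] phi e => [g|k].
  by apply: Pol2_eq => H psi q u; rewrite Pol2_eval_one //; apply: e.
apply: IHn => H psi q u; apply: eq_polynomialS (e H psi q u k) => g.
by rewrite /Delta /= Pol2_eval_mul // Pol2_eval_inv.
Qed.

Theorem pol2_is_Pol2 : is_Pol2 pol2.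
Proof.
split.
- apply: Pol2_polynomialS => H psi q u.
  by apply: eq_polynomialS (q) => g; symmetry; apply: Pol2_eval_pol2.
- by apply: Pol2_eq => H psi q u; rewrite Pol2_eval_one // Pol2_eval_pi //= mulg1 [LHS]u.
move=> H psi q u.
have evM : {morph Pol2_eval psi : x y / x * y} by move=> x y; apply: Pol2_eval_mul.
pose fM := isMultiplicative.Build Pol2 H (Pol2_eval psi) evM.
pose f : {multiplicative Pol2 -> H} := HB.pack (Pol2_eval psi) fM.
exists f; split=> [g|g gpsi x]; first exact: Pol2_eval_pol2.
have g1 : g 1 = 1 by apply: (mulgI (g 1)); rewrite -gmulfM !mulg1.
have gV (y : Pol2) : g y^-1 = (g y)^-1.
  by apply: (mulgI (g y)); rewrite -gmulfM !mulgV.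
have gpi (w : word) : g (Pol2_pi w) = word_eval psi w.
  elim: w => /= [|l w <-]; first exact: g1.
  have -> : letter_eval psi l = g (Pol2_pi [:: l]).
    rewrite /letter_eval; case: l => [[] h] /=; rewrite -gpsi //= -gV.
    congr (g _); apply: Pol2_eq => K chi qc uc.
    by rewrite Pol2_eval_inv // !Pol2_eval_pi //= !mulg1.
  rewrite -gmulfM; congr (g _); apply: Pol2_eq => K chi qc uc.
  by rewrite Pol2_eval_mul // !Pol2_eval_pi //= mulg1.
by rewrite -[LHS]/(g x) -[in LHS](reprK x) [LHS]gpi.
Qed.

End Pol2.

(* Main.v *)
(* For an abelian group A, Pol_2^ab(G) -> A is the same as a unital quadratic
   map psi : G -> A.  Its cross effect psi (x + y) - psi x - psi y is
   biadditive, so it vanishes when x and y are p- and q-primary with p <> q: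
   psi is determined by its restrictions to the G_p through
   psi (\sum_p x_p) = \sum_p psi x_p, and these restrictions are arbitrary.
   Only the primes dividing the exponent matter, so the sums are finite. *)
Require Import Defs.
From HB Require Import structures.
From mathcomp Require Import all_boot all_order all_algebra.
From mathcomp Require Import boolp classical_sets cardinality.

Set Implicit Arguments.
Unset Strict Implicit.
Unset Printing Implicit Defensive.

Import GRing.Theory.

Local Open Scope ring_scope.

Notation mult := Algebra.to_multiplicative.

(** * Polynomial maps composed with homomorphisms and read coordinatewise *)

Lemma gmulf1_group (P H : groupType) (f : {multiplicative P -> H}) :
  f 1%g = 1%g.
Proof. by apply: (mulgI (f 1%g)); rewrite -gmulfM !mulg1. Qed.

Lemma gmulfV_group (P H : groupType) (f : {multiplicative P -> H}) x :
  f x^-1%g = (f x)^-1%g.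
Proof. by apply: (mulgI (f x)); rewrite -gmulfM !mulgV gmulf1_group. Qed.

Lemma polynomialS_compl n (G H K : groupType) (f : {multiplicative H -> K})
  (psi : G -> H) : polynomialS n psi -> polynomialS n (f \o psi).
Proof.
elim: n psi => [|n IHn] psi /= q => [g|k]; first by rewrite q gmulf1_group.
apply: eq_polynomialS (IHn _ (q k)) => g.
by rewrite /Delta /= gmulfM gmulfV_group.
Qed.

(** Differences pull back: [Delta k (psi \o h)] is [Delta (h k) psi \o h]. *)
Lemma polynomialS_compr n (G H K : groupType) (h : {multiplicative K -> G})
  (psi : G -> H) : polynomialS n psi -> polynomialS n (psi \o h).
Proof.
elim: n psi => [|n IHn] psi /= q => [g|k]; first exact: q.
by apply: eq_polynomialS (IHn _ (q (h k))) => g; rewrite /Delta /= gmulfM.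
Qed.

Lemma polynomialS_dsum n (G : groupType) (I : Type) (A : I -> zmodType)
  (psi : G -> dsum A) :
  (forall i, @polynomialS n G (mult (A i)) (fun g => dsum_val (psi g) i)) ->
  @polynomialS n G (mult (dsum A)) psi.
Proof.
elim: n psi => [|n IHn] psi /= q => [g|k].
  by apply: val_inj; apply: functional_extensionality_dep => i; apply: q.
by apply: IHn => i; apply: eq_polynomialS (q i k).
Qed.

(** * The universal property of the abelianized Pol_2 among abelian groups *)

Definition ab_projm (P : groupType) : P -> mult (abelianization P) :=
  @ab_proj P.
HB.instance Definition _ (P : groupType) :=
  isMultiplicative.Build P (mult (abelianization P)) (@ab_projm P)
    (@ab_projM P).

Section AbelianizationUniversal.
Variables (P : groupType) (A : zmodType).

(** A homomorphism to an abelian group kills commutators, so [f \o ab_repr] does not depend on the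
    chosen representatives. *)
Lemma ab_factor (f : {multiplicative P -> mult A}) :
  exists h : {additive abelianization P -> A}, forall x, h (ab_proj x) = f x.
Proof.
have f_der x : derived x -> f x = 1%g.
  elim=> {x} [x y||x y _ fx _ fy|x _ fx].
  - rewrite commgEl conjgE !gmulfM !gmulfV_group.
    move: (f x : A) (f y : A) => u v.
    change (- u + (- v + (u + v)) = 0).
    by rewrite addrCA addKr addNr.
  - exact: gmulf1_group.
  - by rewrite gmulfM fx fy mulg1.
  - by rewrite gmulfV_group fx invg1.
have f_proj x : f (ab_repr (ab_proj x)) = f x.
  have /ab_projP/f_der := ab_reprK (ab_proj x).
  rewrite gmulfM gmulfV_group => /(congr1 (fun z => z * f x)%g).
  by rewrite mulgVK mul1g.
have hD : zmod_morphism (fun a => f (ab_repr a) : A).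
  move=> a b; rewrite -(ab_reprK a) -(ab_reprK b).
  have -> : ab_proj (ab_repr a) - ab_proj (ab_repr b)
            = ab_proj (ab_repr a * (ab_repr b)^-1)%g.
    by rewrite ab_projM -[in RHS]ab_proj_opp.
  by rewrite !f_proj gmulfM gmulfV_group.
pose hM := GRing.isZmodMorphism.Build (abelianization P) A _ hD.
pose h : {additive abelianization P -> A} :=
  HB.pack (fun a => f (ab_repr a) : A) hM.
by exists h.
Qed.

Variables (G : groupType) (phi : G -> P).
Hypothesis phiP : is_Pol2 phi.

Lemma ab_Pol2_factor (psi : G -> A) :
  @quadratic G (mult A) psi -> @unital G (mult A) psi ->
  exists h : {additive abelianization P -> A},
    forall x, h (ab_proj (phi x)) = psi x.
Proof.
move=> q u; have [_ _ univ] := phiP; have [f [fpsi _]] := univ _ _ q u.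
by have [h hf] := ab_factor f; exists h => x; rewrite hf -fpsi.
Qed.

(** Composed with the projection from [P], both maps become homomorphisms that factor the same
    unital quadratic map, so uniqueness in [is_Pol2] identifies them. Below, this reduces identities
    of additive maps to a check on generators. *)
Lemma ab_Pol2_ext (f g : {additive abelianization P -> A}) :
  (forall x, f (ab_proj (phi x)) = g (ab_proj (phi x))) -> f =1 g.
Proof.
have [q u univ] := phiP.
pose pm (h : {additive abelianization P -> A}) :
  {multiplicative P -> mult A} := Algebra.to_fmultiplicative h \o @ab_projm P.
move=> fg a; rewrite -(ab_reprK a).
have qf := @polynomialS_compl 3 _ _ _ (pm f) phi q.
have uf : unital (pm f \o phi).
  by rewrite /unital -[LHS]/(pm f (phi 1%g)) [phi _]u gmulf1_group.
have [h [_ hU]] := univ _ _ qf uf.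
rewrite -[LHS]/(pm f _) -[RHS]/(pm g _) (hU (pm f)) // (hU (pm g)) // => x.
exact/esym/fg.
Qed.

End AbelianizationUniversal.


(** * Torsion and the idempotents of the primary decomposition *)

Section Torsion.
Variable G : zmodType.
Implicit Types (x y z : G) (m n k l p q : nat).

Lemma mulrn_coprime0 z m n :
  coprime m n -> z *+ m = 0 -> z *+ n = 0 -> z = 0.
Proof.
move=> co zm zn; have [m0|m_gt0] := posnP m.
  by move: co zn; rewrite m0 /coprime gcd0n => /eqP ->.
have [a _ /dvdnP[c e]] := Bezoutl n m_gt0.
have: z *+ (gcdn m n + a * n) = 0 by rewrite e mulnC mulrnA zm mul0rn.
rewrite (eqP co) mulrnDr [(a * n)%N]mulnC [z *+ (n * a)]mulrnA zn mul0rn.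
by rewrite addr0.
Qed.

Lemma mulrn_dvd0 z m n : (m %| n)%N -> z *+ m = 0 -> z *+ n = 0.
Proof. by move=> /dvdnP[c ->] zm; rewrite mulnC mulrnA zm mul0rn. Qed.

Lemma mulrn_modn z m : z *+ m = 0 -> forall a, z *+ (a %% m) = z *+ a.
Proof.
move=> zm a; rewrite [in RHS](divn_eq a m) mulrnDr.
by rewrite mulnC [z *+ (m * _)]mulrnA zm mul0rn add0r.
Qed.

Lemma mulrn_part z p n :
  prime p -> (0 < n)%N -> z *+ n = 0 -> z \in @in_primary G p ->
  z *+ n`_p = 0.
Proof.
move=> pp n0 zn /asboolP[k zk].
apply: (@mulrn_coprime0 _ (p ^ k) n`_p^').
- by apply: (@pnat_coprime p); rewrite ?part_pnat // pnatX pnat_id.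
- by rewrite -mulrnA mulnC mulrnA zk mul0rn.
- by rewrite -mulrnA partnC.
Qed.
End Torsion.

(* The residue modulo [n] that acts on a group of exponent [n] as the
   projection onto its [p]-primary part. *)
Definition primary_idem (n p : nat) : nat := chinese n`_p n`_p^' 1 0.

Lemma idem_modp n (p : nat) : primary_idem n p = 1 %[mod n`_p].
Proof. by apply: chinese_modl; apply: coprime_partC. Qed.

Lemma dvdn_idem n (p : nat) : (n`_p^' %| primary_idem n p)%N.
Proof. by rewrite /dvdn chinese_modr ?mod0n //; apply: coprime_partC. Qed.

Lemma dvdn_part_idem n (p q : nat) : (0 < n)%N -> p != q ->
  (n`_q %| primary_idem n p)%N.
Proof.
move=> n_gt0 pq; apply: dvdn_trans (dvdn_idem n p).
(* As [q] differs from [p], the [q]-part of [n] is prime to [p], hence divides the [p']-part. *)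
have <- : (n`_q`_p^' = n`_q)%N.
  apply: part_pnat_id; apply: sub_in_pnat (part_pnat q n) => r _.
  by rewrite !inE => /eqP ->; rewrite eq_sym.
by apply: partn_dvd; rewrite ?dvdn_part.
Qed.

(** * Primary projections of a group of bounded exponent *)

Section BoundedExponent.
Variables (G : zmodType) (n : nat).
Hypotheses (n_gt0 : (0 < n)%N) (nG : forall x : G, x *+ n = 0).

Lemma mulrn_idem_in p (x : G) : x *+ primary_idem n p \in @in_primary G p.
Proof.
apply/asboolP; exists (logn p n); rewrite -p_part -mulrnA.
apply: mulrn_dvd0 (nG x).
by rewrite -{1}(partnC p n_gt0) mulnC dvdn_mul ?dvdn_idem.
Qed.

Definition prim_proj p (x : G) : mult (primary G p) :=
  Primary (mulrn_idem_in p x).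

Lemma prim_projM p :
  {morph (prim_proj p : mult G -> mult (primary G p)) : x y / (x * y)%g}.
Proof. by move=> x y; apply: val_inj; apply: mulrnDl. Qed.

Lemma mulrn_idem_sum (x : G) :
  x = \sum_(p <- primes n) x *+ primary_idem n p.
Proof.
(* The idempotents sum to 1 modulo [n]. Adding [n.-1] on both sides avoids subtraction in [nat]: it
   remains that [n] divides the sum plus [n.-1], which is checked on each prime-power part of
   [n]. *)
apply: (addIr (x *+ n.-1)); rewrite sumrMnr -mulrS prednK // nG -mulrnDr.
symmetry; apply: mulrn_dvd0 (nG x).
apply/dvdn_partP => // q; rewrite inE /= => qn.
rewrite (bigD1_seq q) ?primes_uniq //= -addnA addnC -addnA.
rewrite dvdn_addr; last first.
  by apply: dvdn_sum => p; apply: dvdn_part_idem.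
rewrite /dvdn -modnDmr idem_modp modnDmr addn1 prednK //.
exact: dvdn_part.
Qed.


(** The primes dividing [n], lifted to the index type of the direct sum. *)
Definition prime_seq : seq {p : nat | prime p} := pmap insub (primes n).

Lemma prime_seq_val : [seq sval p | p <- prime_seq] = primes n.
Proof.
rewrite (pmap_filter (insubK _)); apply/all_filterP/allP => p.
by rewrite mem_primes => /andP[pp _]; rewrite /= insubT.
Qed.

Lemma prime_seq_uniq : uniq prime_seq.
Proof. exact: pmap_sub_uniq (primes_uniq n). Qed.

Lemma primary_triv (p : {p : nat | prime p}) (x : primary G (sval p)) :
  p \notin prime_seq -> x = 0.
Proof.
rewrite mem_pmap_sub => np; apply: val_inj => /=.
have := mulrn_part (svalP p) n_gt0 (nG (val x)) (valP x).
rewrite part_p'nat ?mulr1n // p'natE ?(svalP p) //.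
by apply: contra np; rewrite mem_primes n_gt0 (svalP p).
Qed.

Lemma prim_proj_id p (x : primary G p) : prime p -> prim_proj p (val x) = x.
Proof.
move=> pp; apply: val_inj => /=.
have xp := mulrn_part pp n_gt0 (nG (val x)) (valP x).
by rewrite -(mulrn_modn xp) idem_modp mulrn_modn.
Qed.

Lemma prim_proj_neq p q (x : primary G q) : prime q -> p != q ->
  prim_proj p (val x) = 0.
Proof.
move=> pq npq; apply: val_inj => /=.
apply: mulrn_dvd0 (mulrn_part pq n_gt0 (nG (val x)) (valP x)).
exact: dvdn_part_idem.
Qed.

HB.instance Definition _ p := isMultiplicative.Build (mult G)
  (mult (primary G p)) (prim_proj p : mult G -> mult (primary G p))
  (prim_projM p).
End BoundedExponent.

(** * Cross effects of quadratic maps between abelian groups *)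

Section QuadraticToAbelian.
Variables (G A : zmodType) (psi : G -> A).
Hypotheses (psi_quad : @quadratic (mult G) (mult A) psi)
  (psi_unital : @unital (mult G) (mult A) psi).

Definition cross x y := psi (x + y) - psi x - psi y.

Lemma crossC x y : cross x y = cross y x.
Proof. by rewrite /cross [x + y]addrC addrAC. Qed.

Lemma crossD x y z : cross x (y + z) = cross x y + cross x z.
Proof.
(* The vanishing third difference at base point 0 is the additivity of [cross] in its second
   argument, up to the term [psi 0], which is 0. *)
have := psi_quad x y z 0; rewrite /Delta.
change (psi (x + (y + (z + 0))) - psi (y + (z + 0)) -
  (psi (x + (z + 0)) - psi (z + 0)) -
  (psi (x + (y + 0)) - psi (y + 0) - (psi (x + 0) - psi 0)) = 0 ->
  cross x (y + z) = cross x y + cross x z).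
rewrite !addr0 (psi_unital : psi 0 = 0) subr0 /cross.
move=> /subr0_eq/(canRL (subrK _)) e.
rewrite addrAC e; move: (- psi x) (- psi y) (- psi z) => x' y' z'.
by rewrite [LHS](AC (3*2*1) (1*3*2*(4*6*5))).
Qed.

Lemma cross0 x : cross x 0 = 0.
Proof. by apply: (addIr (cross x 0)); rewrite -crossD addr0 add0r. Qed.

Lemma crossMn x y k : cross x (y *+ k) = cross x y *+ k.
Proof. by elim: k => [|k IHk]; rewrite ?cross0 // !mulrS crossD IHk. Qed.

(** By biadditivity the cross effect is killed by a power of [p] and by a power of [q], which are
    coprime. *)
Lemma cross_primary p q x y : prime p -> prime q -> p != q ->
  x \in @in_primary G p -> y \in @in_primary G q -> cross x y = 0.
Proof.
move=> pp pq npq /asboolP[k xk] /asboolP[l yl].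
apply: (@mulrn_coprime0 _ _ (p ^ k) (q ^ l)).
- by rewrite coprimeXl // coprimeXr // prime_coprime // dvdn_prime2.
- by rewrite crossC -crossMn xk cross0.
- by rewrite -crossMn yl cross0.
Qed.

Lemma quadratic_sum_primary (s : seq nat) (x : nat -> G) :
  uniq s -> all prime s ->
  {in s, forall p, x p \in @in_primary G p} ->
  psi (\sum_(p <- s) x p) = \sum_(p <- s) psi (x p).
Proof.
elim: s => [|p s IHs] /=; first by rewrite !big_nil.
move=> /andP[ps us] /andP[pp sp] xs; rewrite !big_cons -IHs //; last first.
  by move=> q qs; apply: xs; rewrite inE qs orbT.
have : cross (x p) (\sum_(q <- s) x q) = 0.
  rewrite (big_morph _ (crossD (x p)) (cross0 (x p))).
  rewrite big_seq big1 // => q qs.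
  apply: (@cross_primary p q).
  - by [].
  - exact: (allP sp).
  - by apply: contraNneq ps => ->.
  - by apply: xs; rewrite mem_head.
  - by apply: xs; rewrite inE qs orbT.
by rewrite /cross => /subr0_eq/(canRL (subrK _)) ->; apply: addrC.
Qed.

End QuadraticToAbelian.

(** * Coordinates of the direct sum and the isomorphism *)

Section Projection.
Variables (I : Type) (A : I -> zmodType) (i : I).

Definition dsum_proj (a : dsum A) : A i := dsum_val a i.

Lemma dsum_proj_is_zmod : zmod_morphism dsum_proj.
Proof. by []. Qed.

HB.instance Definition _ :=
  GRing.isZmodMorphism.Build (dsum A) (A i) dsum_proj dsum_proj_is_zmod.
End Projection.

HB.instance Definition _ (G : zmodType) (p : nat) :=
  isMultiplicative.Build (mult (primary G p)) (mult G)
    (@primary_val G p : mult (primary G p) -> mult G)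
    (fun x y => erefl _).

Local Close Scope ring_scope.

Theorem proposition5p3
  (G : zmodType)
  (G_bounded : exists n : nat, (0 < n)%N /\ forall x : G, (x *+ n)%R = 0%R)
  (P : groupType) (phi : Algebra.to_multiplicative G -> P)
  (phi_Pol2 : is_Pol2 phi)
  (Pp : {p : nat | prime p} -> groupType)
  (phip : forall p : {p : nat | prime p},
      Algebra.to_multiplicative (primary G (sval p)) -> Pp p)
  (phip_Pol2 : forall p : {p : nat | prime p}, is_Pol2 (phip p)) :
  exists f : {additive abelianization P ->
                dsum (fun p : {p : nat | prime p} => abelianization (Pp p))},
    bijective f.

Proof.
have [n [n_gt0 nG]] := G_bounded.
have [phi_q phi_u _] := phi_Pol2.
pose A (p : {p : nat | prime p}) : zmodType := abelianization (Pp p).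
pose s := prime_seq n.
have A_triv p (a : A p) : p \notin s -> a = 0%R.
  move=> ps; rewrite -[LHS]/(idfun a) -[RHS]/((\0%R : {additive A p -> A p}) a).
  (* For [p] outside [s] the primary part is zero and [phip p] is unital, so the identity and the
     zero map of [A p] agree on generators. *)
  apply: (ab_Pol2_ext (phip_Pol2 p)) => x /=.
  have [_ u _] := phip_Pol2 p.
  by rewrite (primary_triv n_gt0 nG x ps) [phip p _]u.
pose c p x : A p := ab_proj (phip p (prim_proj n_gt0 nG (sval p) x)).
have c_fin x : (c^~ x : dprod A) \in @finsupp _ A.
  apply/asboolP; apply: sub_finite_set (finite_seq s) => p /= cp.
  by apply: contrapT => /negP ps; apply: cp; apply: A_triv.
(* The forward map [f] is induced by [psi], which sends [x] to the classes of its primary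
   components. *)
pose psi x : dsum A := Dsum (c_fin x).
have psi_q : @quadratic (mult G) (mult (dsum A)) psi.
  apply: polynomialS_dsum => p; have [q _ _] := phip_Pol2 p.
  have := polynomialS_compr (prim_proj n_gt0 nG (sval p)) q.
  exact: (polynomialS_compl (@ab_projm (Pp p))).
have psi_u : @unital (mult G) (mult (dsum A)) psi.
  apply: val_inj; apply: functional_extensionality_dep => p.
  have [_ u _] := phip_Pol2 p.
  rewrite -[LHS]/(ab_proj (phip p (prim_proj n_gt0 nG (sval p) 0%R))).
  have -> : prim_proj n_gt0 nG (sval p) 0%R = 0%R by apply: gmulf1_group.
  by rewrite [phip p _]u.
have phib_q : @quadratic (mult G) (mult (abelianization P)) (@ab_proj P \o phi).
  exact: (polynomialS_compl (@ab_projm P) phi_q).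
have phib_u : @unital (mult G) (mult (abelianization P)) (@ab_proj P \o phi).
  by rewrite /unital /= [phi _]phi_u.
have [f fE] := ab_Pol2_factor phi_Pol2 psi_q psi_u.
(* The inclusion of each primary part, followed by the universal map of [G], induces the component
   [g_ p] of the inverse. *)
have g_ex p : exists h : {additive A p -> abelianization P},
    forall y, h (ab_proj (phip p y)) = ab_proj (phi (val y)).
  apply: (ab_Pol2_factor (phip_Pol2 p)).
    exact: (polynomialS_compr (@primary_val G (sval p)) phib_q).
  exact: phib_u.
pose g_ p := sval (cid (g_ex p)).
have gE p : forall y, g_ p (ab_proj (phip p y)) = ab_proj (phi (val y)).
  exact: svalP (cid (g_ex p)).
(* Summing over [s] suffices, since the other summands [A p] are trivial. *)
pose g (a : dsum A) : abelianization P :=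
  (\sum_(p <- s) g_ p (dsum_proj p a))%R.
have gB : zmod_morphism g.
  by move=> a b; rewrite /g -sumrB; apply: eq_bigr => p _; rewrite !raddfB.
pose ga : {additive dsum A -> abelianization P} :=
  HB.pack g (GRing.isZmodMorphism.Build (dsum A) _ g gB).
exists f; exists g.
  move=> a; rewrite -[LHS]/((ga \o f) a) -[RHS]/(idfun a).
  apply: (ab_Pol2_ext phi_Pol2) => x; rewrite /= fE /g.
  (* On a generator, [g \o f] gives the sum of the values at the primary components of [x];
     vanishing cross effects turn it into the value at [x]. *)
  have := quadratic_sum_primary phib_q phib_u (primes_uniq n) _
    (fun p _ => mulrn_idem_in n_gt0 nG p x).
  rewrite -(mulrn_idem_sum n_gt0 nG) /= => ->.
    by rewrite -prime_seq_val big_map; apply: eq_bigr => p _; rewrite gE.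
  by apply/allP => p; rewrite mem_primes => /andP[].
(* For [f \o g], the matrix of components [A r -> A p] is computed: zero off the diagonal, since an
   [r]-primary element has trivial [p]-component, and the identity on it. *)
have fg p r (b : A r) : r != p -> dsum_proj p (f (g_ r b)) = 0%R.
  move=> rp; rewrite -[LHS]/((@dsum_proj _ A p \o f \o g_ r) b).
  rewrite -[RHS]/((\0%R : {additive A r -> A p}) b).
  apply: (ab_Pol2_ext (phip_Pol2 r)) => y /=.
  rewrite gE fE /dsum_proj /= /c prim_proj_neq ?(svalP r) //; last first.
    by rewrite eq_sym.
  by have [_ u _] := phip_Pol2 p; rewrite [phip p _]u.
have fgp p (b : A p) : dsum_proj p (f (g_ p b)) = b.
  rewrite -[LHS]/((@dsum_proj _ A p \o f \o g_ p) b) -[RHS]/(idfun b).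
  apply: (ab_Pol2_ext (phip_Pol2 p)) => y /=.
  by rewrite gE fE /dsum_proj /= /c prim_proj_id ?(svalP p).
move=> a; apply: val_inj; apply: functional_extensionality_dep => p.
rewrite -[LHS]/(dsum_proj p (f (g a))) -[RHS]/(dsum_proj p a).
have [ps|ps] := boolP (p \in s); last by rewrite !(A_triv p (dsum_proj p _)).
rewrite /g !raddf_sum (bigD1_seq p) ?prime_seq_uniq //= fgp big1 ?addr0 //.
by move=> r rp; apply: fg.
Qed.
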